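(* Let $d\ge 5$ be an integer. Every finite poset $P$ whose comparability graph has maximum degree at most $d$ satisfies $\dim(P)\le 50\, d\log d$.
   Context: A poset $P$ consists of a ground set $X$ together with a partial order $\preceq_P$ on $X$ (a reflexive, antisymmetric, transitive relation); write $x\prec_P y$ if $x\preceq_P y$ and $x\neq y$. Elements $x,y$ are comparable if $x\preceq_P y$ or $y\preceq_P x$. The comparability graph of $P$ is the graph with vertex set $X$ in which two distinct elements $x,y$ are adjacent if and only if they are comparable in $P$. A linear order $L$ on a finite set $X$ is an ordering $(x_1,\dots,x_n)$ of the elements of $X$, with $x_i\prec_L x_j$ if and only if $i<j$. For a finite poset $P$ with ground set $X$, the dimension $\dim(P)$ is the smallest integer $k\ge 0$ for which there exist linear orders $L_1,\dots,L_k$ on $X$ such that, for all distinct $x,y\in X$, we have $x\prec_P y$ if and only if $x\prec_{L_i} y$ for every $i\in\{1,\dots,k\}$. All logarithms are to base $e$. *)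

(* Defs.v *)
From HB Require Import structures.
From mathcomp Require Import all_boot all_order.

Set Implicit Arguments.
Unset Strict Implicit.
Unset Printing Implicit Defensive.

Import Order.TTheory.

(* Simple graphs on a finite type are given by their adjacency relation. *)
Definition max_degree (V : finType) (adj : rel V) : nat :=
  \max_(x : V) #|[set y | adj x y]|.

Definition comparability_graph (disp : Order.disp_t) (P : finPOrderType disp) :
    rel P :=
  fun x y => (x != y) && (x >=< y)%O.
Arguments comparability_graph {disp} P x y.

(* A linear order on T is an ordering (x_1, ..., x_n) of all the elements
   of T: a duplicate-free tuple of length #|T|. *)
Definition linear_order (T : finType) := {t : #|T|.-tuple T | uniq t}.

Definition lin_lt (T : finType) (L : linear_order T) : rel T :=
  fun x y => index x (val L) < index y (val L).

Definition realizer (disp : Order.disp_t) (P : finPOrderType disp) (k : nat)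
    (L : {ffun 'I_k -> linear_order P}) : bool :=
  [forall x : P, forall y : P,
     (x != y) ==> ((x < y)%O == [forall i : 'I_k, lin_lt (L i) x y])].

Definition has_realizer (disp : Order.disp_t) (P : finPOrderType disp) :
    pred nat :=
  fun k => [exists L : {ffun 'I_k -> linear_order P}, realizer L].

Lemma key_linear_order (T : finType) (f : T -> nat) :
  exists L : linear_order T, forall x y, f x < f y -> lin_lt L x y.
Proof.
pose r := relpre f leq.
pose s := sort r (enum T).
have sz : size s == #|T| by rewrite size_sort cardE.
have us : uniq s by rewrite sort_uniq enum_uniq.
exists (exist (fun t : #|T|.-tuple T => uniq t) (Tuple sz) us) => x y fxy.
rewrite /lin_lt /= ltnNge; apply/negP => le_yx.
have srt : sorted r s by apply: sort_sorted => a b; apply: leq_total.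
have tr : transitive r by move=> a b c; apply: leq_trans.
have rr : reflexive r by move=> a; apply: leqnn.
have ms z : z \in s by rewrite mem_sort mem_enum.
have := sorted_leq_index tr rr srt y x (ms y) (ms x) le_yx.
by rewrite /r /= leqNgt fxy.
Qed.

Lemma ex_realizer (disp : Order.disp_t) (P : finPOrderType disp) :
  exists k, has_realizer P k.
Proof.
pose E := [set L : linear_order P |
  [forall x : P, forall y : P, (x < y)%O ==> lin_lt L x y]].
have EP (L : linear_order P) (x y : P) : L \in E -> (x < y)%O -> lin_lt L x y.
  by rewrite inE => /forallP/(_ x)/forallP/(_ y)/implyP.
exists #|E|; apply/existsP; exists [ffun i => enum_val i].
apply/forallP=> x; apply/forallP=> y; apply/implyP=> nxy.
apply/eqP; apply/idP/forallP => [ltxy i|allL].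
  by rewrite ffunE; apply: EP ltxy; apply: enum_valP.
apply/negPn/negP => nltxy.
have nlexy : ~~ (x <= y)%O by rewrite le_eqVlt negb_or nxy.
pose h (z : P) := #|[set w : P | (w <= z)%O]|.
have hlt (a b : P) : (a < b)%O -> h a < h b.
  move=> ltab; apply: proper_card; apply/properP; split.
    by apply/subsetP=> w; rewrite !inE => /le_trans; apply; apply: ltW.
  by exists b; rewrite !inE ?lexx // lt_geF.
pose f (z : P) := if (z <= y)%O then h z else #|P| + h z.
have [L Lf] := key_linear_order f.
have LE : L \in E.
  rewrite inE; apply/forallP=> a; apply/forallP=> b; apply/implyP=> ltab.
  apply: Lf; rewrite /f; case: (boolP (b <= y)%O) => [leby|_].
    by rewrite (le_trans (ltW ltab) leby) hlt.
  by case: ifP => _; rewrite ?ltn_add2l ?hlt // ltn_addl ?hlt.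
have := allL (enum_rank_in LE L); rewrite ffunE enum_rankK_in //.
suff : lin_lt L y x by rewrite /lin_lt => /ltnW; rewrite leqNgt => /negbTE ->.
apply: Lf; rewrite /f lexx (negbTE nlexy).
apply: (@leq_ltn_trans #|P|); first exact: max_card.
rewrite -[ltnLHS]addn0 ltn_add2l; apply/card_gt0P; exists x.
by rewrite inE lexx.
Qed.

Definition poset_dim (disp : Order.disp_t) (P : finPOrderType disp) : nat :=
  ex_minn (ex_realizer P).

(* Main.v *)
Require Import Defs.
From mathcomp Require Import all_boot all_order all_algebra.
From mathcomp Require Import reals exp.
From mathcomp Require Import fingroup perm.
From mathcomp Require Import zify ring lra.

(** A key on the elements of a poset gives a linear extension: rank z by the
    largest key in its down-set D(z).  This extension puts x above y as soon
    as the key of x exceeds all keys in D(y).  A random order of the elements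
    does this for a given pair with probability at least 1/(d + 2), because
    |D(y)| <= d + 1; but the number of random orders that serve all pairs
    together grows with the size of the poset.  The orders are therefore
    applied to colours, whose number n = 4 (d+1)^4 depends on d only.

    Let p colour the elements, and let s_1, ..., s_t be permutations of the
    n colours.  Suppose that for every y
      - p is injective on D(y), and
      - for every colour c there is an s_j that puts c above all the other
        colours of p(D(y)).
    Then 2t linear extensions realize the poset ([poset_dim_le_colouring]):
    for every j, the key is s_j of the colour, with ties within a colour class
    broken by a fixed enumeration in one extension and by its reverse in a
    second one.  Indeed, if x is not below y, take s_j for the colour c of x.
    The only possible obstacle is the single element w of D(y) coloured c, and
    one of the two tie-breaks puts x above w.  Only the colour of
    x and the colouring of D(y) enter, so it does not matter how many x there
    are or how far they lie from y.

    Such permutations and colourings are found in two steps.  First, averaging over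
    all tuples of t = O(d log d) permutations gives one tuple for which all
    but a fraction 1/poly(d) of the maps from a (d+1)-set to the colours
    satisfy the second condition ([permutation_family]); non-injective maps
    are rare by the birthday bound ([card_noninj]).  Second, with that tuple
    fixed, the event that a random colouring fails at y depends on D(y) only,
    and D(y) meets at most (d+1)^2 down-sets, so the Lovasz local lemma
    ([local_lemma]) gives a colouring that fails nowhere.

    Probabilities are ratios of cardinals over finite sets of functions
    throughout. *)

Set Implicit Arguments.
Unset Strict Implicit.
Unset Printing Implicit Defensive.

Import Order.TTheory GRing.Theory Num.Theory.

(** * Uniformly random functions and the local lemma *)

(** For independent uniform p : V -> T and g : U -> T, exchange the values of p
    on S with those of g on f(S).  This is an injection on pairs (p, g), and it
    takes the pairs with p in A into W x B; hence Pr[A] <= Pr[W] Pr[B].  With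
    U = V and f the identity it bounds the probability that two events
    depending on disjoint sets of coordinates both occur; with W everything it
    bounds the probability of an event depending on S by that of its copy
    over U. *)
Lemma resample_card (V U T : finType) (S : {set V}) (f : V -> U)
    (A W : {set {ffun V -> T}}) (B : {set {ffun U -> T}}) :
  {in S &, injective f} ->
  (forall p q : {ffun V -> T}, p \in A ->
     (forall v, v \notin S -> q v = p v) -> q \in W) ->
  (forall (p : {ffun V -> T}) (g : {ffun U -> T}), p \in A ->
     (forall v, v \in S -> g (f v) = p v) -> g \in B) ->
  #|A| * #|{ffun U -> T}| <= #|W| * #|B|.
Proof.
move=> finj AW AB.
pose out (x : {ffun V -> T} * {ffun U -> T}) : {ffun V -> T} :=
  [ffun v => if v \in S then x.2 (f v) else x.1 v].
pose inn (x : {ffun V -> T} * {ffun U -> T}) : {ffun U -> T} :=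
  [ffun u => if [pick v in S | f v == u] is Some v then x.1 v else x.2 u].
have innE x v : v \in S -> inn x (f v) = x.1 v.
  move=> vS; rewrite ffunE; case: pickP => [w /andP[wS /eqP /finj->]//|].
  by move/(_ v); rewrite vS eqxx.
have swap_inj : injective (fun x => (out x, inn x)).
  move=> [p g] [p' g'] [/ffunP eo /ffunP ei]; congr pair; apply/ffunP.
    move=> v; case: (boolP (v \in S)) => vS.
      by have := ei (f v); rewrite !innE.
    by have := eo v; rewrite !ffunE (negbTE vS).
  move=> u; have := ei u; rewrite !ffunE /=; case: pickP => // v.
  by case/andP=> vS /eqP <- _; have := eo v; rewrite !ffunE vS.
rewrite -[#|{ffun U -> T}|]cardsT -!cardsX -(card_imset _ swap_inj).
apply/subset_leq_card/subsetP=> y /imsetP[[p g]].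
rewrite in_setX => /andP[pA _] ->{y}.
rewrite in_setX; apply/andP; split => /=.
  by apply: AW pA _ => v vS; rewrite ffunE (negbTE vS).
by apply: AB pA _ => v vS; rewrite innE.
Qed.

(** Symmetric Lovasz local lemma, in the form 4kp <= 1.  The usual induction
    shows that each bad event has conditional probability at most 1/(2k) given
    that any family J of bad events is avoided. *)
Lemma local_lemma (V T I : finType) (D : I -> {set V})
    (bad : I -> {set {ffun V -> T}}) (k : nat) :
  0 < #|T| -> 0 < k ->
  (forall i (p q : {ffun V -> T}),
     (forall v, v \in D i -> q v = p v) -> p \in bad i -> q \in bad i) ->
  (forall i, #|[set j | ~~ [disjoint D i & D j]]| <= k) ->
  (forall i, 4 * k * #|bad i| <= #|{ffun V -> T}|) ->
  exists p : {ffun V -> T}, forall i, p \notin bad i.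
Proof.
move=> T0 k0 local degD badP.
pose good (J : {set I}) := [set p | [forall j in J, p \notin bad j]].
have goodP (J : {set I}) p :
    reflect (forall j, j \in J -> p \notin bad j) (p \in good J).
  by rewrite inE; apply: (iffP forall_inP).
have O0 : 0 < #|{ffun V -> T}| by rewrite card_ffun expn_gt0 T0.
have cond_le n (J : {set I}) i :
    #|J| <= n -> 2 * k * #|bad i :&: good J| <= #|good J|.
  elim: n J i => [|n IHn] J i leJ.
    have -> : good J = setT.
      apply/setP=> p; rewrite [RHS]inE; apply/goodP=> j.
      by move: leJ; rewrite leqn0 => /eqP/cards0_eq->; rewrite inE.
    by rewrite setIT cardsT (leq_trans _ (badP i)) // !leq_mul.
  pose J1 := [set j in J | ~~ [disjoint D i & D j]].
  pose J2 := [set j in J | [disjoint D i & D j]].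
  have JE : J = J1 :|: J2.
    by apply/setP=> j; rewrite !inE; case: (j \in J); case: [disjoint _ & _].
  have sub2 : good J \subset good J2.
    apply/subsetP=> p /goodP gp; apply/goodP=> j jJ2; apply: gp.
    by rewrite JE inE jJ2 orbT.
  (* Avoiding J2 does not depend on the coordinates in D i. *)
  have indep :
      #|bad i :&: good J2| * #|{ffun V -> T}| <= #|good J2| * #|bad i|.
    apply: (@resample_card _ _ _ (D i) id) => // p q /setIP[bp gp] pq.
      apply/goodP=> j jJ2; have := goodP _ _ gp j jJ2.
      apply: contra => bq; apply: local bq => v vD.
      rewrite pq //; apply/negP=> vDi.
      move: jJ2; rewrite inE => /andP[_ /pred0P/(_ v)] /=.
      by rewrite vDi vD.
    exact: local bp.
  have b2 : 4 * k * #|bad i :&: good J2| <= #|good J2|.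
    by rewrite -(leq_pmul2r O0); have := badP i; nia.
  have sub : #|bad i :&: good J| <= #|bad i :&: good J2|.
    by apply/subset_leq_card/setIS.
  have [J10|J1n0] := eqVneq J1 set0.
    by have -> : good J = good J2; [rewrite JE J10 set0U | nia].
  have lt2 : #|J2| <= n.
    rewrite -ltnS; apply: leq_trans leJ; apply: proper_card.
    apply/properP; split; first by rewrite JE subsetUr.
    by have /set0Pn[j j1] := J1n0; move: j1; rewrite inE => /andP[jJ nd];
      exists j; rewrite // inE jJ.
  (* By induction, given that J2 is avoided, some event of J1 occurs with
     probability at most k/(2k); so conditioning on J1 as well at most doubles
     the probability of bad i. *)
  have half : #|good J2| <= #|good J| + \sum_(j in J1) #|bad j :&: good J2|.
    apply: (@leq_trans (#|good J :|: \bigcup_(j in J1) (bad j :&: good J2)|)).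
      apply/subset_leq_card/subsetP=> p gp; rewrite inE.
      case: (boolP [exists j in J1, p \in bad j]).
        case/exists_inP=> j j1 bj; apply/orP; right.
        by apply/bigcupP; exists j => //; rewrite inE bj.
      rewrite negb_exists_in => /forall_inP h; apply/orP; left; apply/goodP=> j.
      rewrite JE inE => /orP[/h//|j2]; exact: (goodP _ _ gp).
    apply: leq_trans (leq_card_setU _ _) _; rewrite leq_add2l.
    elim/big_rec2: _ => [|j X Y _ le]; first by rewrite cards0.
    by apply: leq_trans (leq_card_setU _ _) _; rewrite leq_add2l.
  have sum1 : 2 * k * \sum_(j in J1) #|bad j :&: good J2| <= k * #|good J2|.
    rewrite big_distrr /=; apply: (@leq_trans (\sum_(j in J1) #|good J2|)).
      by apply: leq_sum => j _; apply: IHn.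
    rewrite sum_nat_const leq_mul2r; apply/orP; right.
    apply: leq_trans (degD i); apply/subset_leq_card/subsetP=> j.
    by rewrite !inE => /andP[].
  have half' : #|good J2| <= 2 * #|good J| by nia.
  nia.
have pos n (J : {set I}) : #|J| = n -> 0 < #|good J|.
  elim: n J => [|n IHn] J cJ.
    have /card_gt0P[p _] := O0; apply/card_gt0P; exists p; apply/goodP=> j.
    by rewrite (cards0_eq cJ) inE.
  have /card_gt0P[i iJ] : 0 < #|J| by rewrite cJ.
  have cJ' : #|J :\ i| = n by move: cJ; rewrite (cardsD1 i) iJ => -[].
  have := IHn _ cJ'; have := cond_le n (J :\ i) i; rewrite cJ' => /(_ (leqnn n)).
  have : #|good (J :\ i)| <= #|good J| + #|bad i :&: good (J :\ i)|.
    apply: leq_trans (leq_card_setU _ _); apply/subset_leq_card/subsetP=> p gp.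
    rewrite !inE; case: (boolP (p \in bad i)) => [bp|nbp].
      by rewrite inE in gp; rewrite gp orbT.
    apply/orP; left; apply/forall_inP=> j jJ; have [->//|ji] := eqVneq j i.
    by apply: (goodP _ _ gp); rewrite !inE ji.
  nia.
have /card_gt0P[p /goodP gp] := pos _ [set: I] erefl.
by exists p => i; apply: gp.
Qed.

(** * Permutations in which a given colour is on top *)

(** The inequality is weak in order to allow c in A; it is strict at the other
    elements of A, as s is injective. *)
Definition tops (n : nat) (s : {perm 'I_n}) (c : 'I_n) (A : {set 'I_n}) :
    bool :=
  [forall a in A, s a <= s c].

(** Every permutation has exactly one top element in A, and transposing a with
    c shows that a and c are on top equally often. *)
Lemma card_tops (n : nat) (c : 'I_n) (A : {set 'I_n}) :
  c \in A -> #|[set s : {perm 'I_n} | tops s c A]| * #|A| = n`!.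
Proof.
move=> cA; pose F a := [set s : {perm 'I_n} | tops s a A].
have eqF a : a \in A -> #|F a| = #|F c|.
  move=> aA; rewrite -(card_imset (mem (F a)) (mulgI (tperm a c))).
  apply: eq_card => s; apply/imsetP/idP.
    move=> [r]; rewrite !inE => /forall_inP ra ->; apply/forall_inP=> b bA.
    rewrite !permM tpermR; apply: ra.
    by case: tpermP => // ->.
  rewrite inE => /forall_inP sc; exists (tperm a c * s)%g.
    rewrite inE; apply/forall_inP=> b bA; rewrite !permM tpermL; apply: sc.
    by case: tpermP.
  by rewrite mulgA tperm2 mul1g.
have cover (s : {perm 'I_n}) : \sum_(a in A) (s \in F a) = 1.
  have [a aA maxa] : {a | a \in A & forall b, b \in A -> s b <= s a}.
    by case: (arg_maxnP (fun a => s a : nat) cA) => a aA; exists a.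
  have aF : s \in F a by rewrite inE; apply/forall_inP.
  rewrite (bigD1 a) //= big1 => [|b /andP[bA ba]]; first by rewrite aF.
  rewrite inE.
  apply/eqP; rewrite eqb0; apply: contra ba => /forall_inP/(_ a aA) le.
  by apply/eqP/(@perm_inj _ s)/val_inj/anti_leq; rewrite le maxa.
rewrite -(card_Sn n) -[RHS]sum1_card -(eq_bigr _ (fun s _ => cover s)).
rewrite exchange_big /=.
rewrite (eq_bigr (fun=> #|F c|)) => [|a aA].
  by rewrite sum_nat_const mulnC.
rewrite -(eqF _ aA) -sum1_card [RHS]big_mkcond.
by apply: eq_bigr => s _; case: (_ \in _).
Qed.

Lemma card_not_tops (n m : nat) (c : 'I_n) (A : {set 'I_n}) :
  #|A| <= m -> #|[set s : {perm 'I_n} | ~~ tops s c A]| * m.+1 <= n`! * m.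
Proof.
move=> leA; have := card_tops (setU11 c A).
have -> : [set s : {perm 'I_n} | tops s c (c |: A)] =
    ~: [set s | ~~ tops s c A].
  apply/setP=> s; rewrite !inE negbK; apply/forall_inP/forall_inP => h a.
    by move=> aA; apply: h; rewrite inE aA orbT.
  by case/setU1P=> [->//|/h].
have : #|c |: A| <= m.+1 by rewrite cardsU1 -add1n leq_add ?leq_b1.
have := cardsC [set s : {perm 'I_n} | ~~ tops s c A].
rewrite card_Sn.
move: #|_| #|~: _| #|_ |: _| n`! => x y a N xy ya aN; nia.
Qed.

(** m + 1 trials, each failing with probability at most m / (m + 1), all fail
    with probability at most 1/2. *)
Lemma doubling_pow (m : nat) : 2 * m ^ m.+1 <= m.+1 ^ m.+1.
Proof.
(* Bernoulli's inequality for (1 + 1/m)^(n+1), multiplied by m^(n+1). *)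
have bern n : m ^ n.+1 + n.+1 * m ^ n <= m.+1 ^ n.+1.
  elim: n => [|n IHn]; first by rewrite !expn1 expn0; lia.
  rewrite [m.+1 ^ n.+2]expnS; apply: leq_trans (leq_mul (leqnn _) IHn).
  rewrite (expnS m n.+1) (expnS m n); nia.
have := bern m; rewrite expnS; nia.
Qed.

Definition misses (n t : nat) (Q : {ffun 'I_t -> {perm 'I_n}}) (c : 'I_n)
    (A : {set 'I_n}) : bool :=
  [forall j, ~~ tops (Q j) c A].

Lemma leq_exp2rW (a b e : nat) : a <= b -> a ^ e <= b ^ e.
Proof. by case: e => // e; rewrite leq_exp2r. Qed.

(** Union bound and averaging: for fixed g and c, a random family of
    (m + 1)k permutations misses c with probability at most 2^-k, so some
    family has at most n^m * n / 2^k bad maps g. *)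
Lemma permutation_family (n m k : nat) :
  exists Q : {ffun 'I_(m.+1 * k) -> {perm 'I_n}},
    2 ^ k * #|[set g : {ffun 'I_m -> 'I_n} |
                [exists c, misses Q c [set g u | u in 'I_m]]]| <= n ^ m.+1.
Proof.
set t := m.+1 * k; pose family := {ffun 'I_t -> {perm 'I_n}}.
pose img (g : {ffun 'I_m -> 'I_n}) := [set g u | u in 'I_m].
pose bad (Q : family) := #|[set g | [exists c, misses Q c (img g)]]|.
pose M := #|family|.
have ME : M = n`! ^ t by rewrite /M card_ffun card_Sn card_ord.
have M0 : 0 < M by rewrite ME expn_gt0 fact_gt0.
have one c (g : {ffun 'I_m -> 'I_n}) :
    2 ^ k * #|[set Q : family | misses Q c (img g)]| <= M.
  set A := img g.
  have leA : #|A| <= m by rewrite (leq_trans (leq_imset_card _ _)) ?card_ord.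
  have -> : #|[set Q : family | misses Q c A]| =
      #|[set s : {perm 'I_n} | ~~ tops s c A]| ^ t.
    rewrite -[t in RHS]card_ord -card_ffun_on; apply: eq_card => Q; rewrite inE.
    apply/forallP/ffun_onP => h j; first by rewrite inE.
    by have := h j; rewrite inE.
  rewrite ME -(@leq_pmul2r (m.+1 ^ t)) ?expn_gt0 // -mulnA -expnMn.
  apply: (@leq_trans (2 ^ k * (n`! * m) ^ t)).
    rewrite leq_mul2l; apply/orP; right.
    apply: leq_exp2rW; exact: card_not_tops.
  rewrite expnMn mulnCA leq_mul2l; apply/orP; right.
  rewrite /t !expnM -expnMn; apply: leq_exp2rW; exact: doubling_pow.
have [/existsP[Q badQ]|none] :=
    boolP [exists Q : family, 2 ^ k * bad Q <= n ^ m.+1].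
  by exists Q.
have : \sum_(Q : family) (n ^ m.+1).+1 <= \sum_(Q : family) 2 ^ k * bad Q.
  apply: leq_sum => Q _; rewrite ltnNge; apply: contra none => le.
  by apply/existsP; exists Q.
have : \sum_(Q : family) 2 ^ k * bad Q <= n ^ m.+1 * M.
  apply: (@leq_trans (\sum_(Q : family) \sum_(x : {ffun 'I_m -> 'I_n} * 'I_n)
      2 ^ k * misses Q x.2 (img x.1))).
    apply: leq_sum => Q _; rewrite -big_distrr leq_mul2l; apply/orP; right.
    rewrite -(pair_bigA _
      (fun (g : {ffun 'I_m -> 'I_n}) c => misses Q c (img g) : nat)) /=.
    rewrite /bad -sum1_card big_mkcond; apply: leq_sum => g _; rewrite inE.
    by case: existsP => // -[c mc]; rewrite (bigD1 c) //= mc.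
  rewrite exchange_big /=.
  apply: (@leq_trans (\sum_(x : {ffun 'I_m -> 'I_n} * 'I_n) M)).
    apply: leq_sum => -[g c] _ /=; apply: leq_trans (one c g).
    rewrite -big_distrr leq_mul2l /= -sum1_card [X in _ <= X]big_mkcond.
    apply/orP; right; apply: leq_sum => Q _.
    by rewrite inE; case: misses.
  by rewrite sum_nat_const card_prod card_ffun !card_ord -expnSr.
rewrite sum_nat_const -/M; nia.
Qed.

(** Birthday bound. *)
Lemma card_noninj (n m : nat) :
  2 * n * #|[set g : {ffun 'I_m -> 'I_n} | ~~ injectiveb g]| <= m * m * n ^ m.
Proof.
have -> : [set g : {ffun 'I_m -> 'I_n} | ~~ injectiveb g] =
    ~: [set g : {ffun 'I_m -> 'I_n} | injectiveb g].
  by apply/setP=> g; rewrite !inE.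
have := cardsC [set g : {ffun 'I_m -> 'I_n} | injectiveb g].
rewrite card_inj_ffuns card_ffun !card_ord.
suff : 2 * n * n ^ m <= m * m * n ^ m + 2 * n * n ^_ m by nia.
elim: m => [|m IHm]; first by rewrite ffactn0 expn0; lia.
rewrite ffactnSr expnS; have [le|lt] := leqP m n.
  have : n = (n - m) + m by lia.
  nia.
nia.
Qed.

(** * Colourings that are good on every set of a sparse family *)

Lemma sub_tops (n : nat) (s : {perm 'I_n}) (c : 'I_n) (A B : {set 'I_n}) :
  A \subset B -> tops s c B -> tops s c A.
Proof.
by move=> /subsetP sAB /forall_inP sB; apply/forall_inP=> a /sAB/sB.
Qed.

(** The local lemma applied to the events that the colouring of D i is not
    injective or that the permutations miss some colour there.  The bounds on
    n and 2^k make each of the two failures have probability at most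
    1/(8 m^2), so that together they meet the condition of the local lemma for
    dependency degree m^2. *)
Lemma good_colouring (V I : finType) (D : I -> {set V}) (m n k : nat) :
  0 < m ->
  (forall i, #|D i| <= m) ->
  (forall i, #|[set j | ~~ [disjoint D i & D j]]| <= m ^ 2) ->
  4 * m ^ 4 <= n -> 8 * m ^ 2 * n <= 2 ^ k ->
  exists (Q : {ffun 'I_(m.+1 * k) -> {perm 'I_n}}) (p : {ffun V -> 'I_n}),
    forall i, {in D i &, injective p} /\
      forall c, exists j, tops (Q j) c [set p v | v in D i].
Proof.
move=> m0 leD degD len lek.
have n0 : 0 < n by apply: leq_trans len; rewrite muln_gt0 expn_gt0 m0.
have [Q badQ] := permutation_family n m k; exists Q.
pose bad i := [set p : {ffun V -> 'I_n} |
  ~~ dinjectiveb p (mem (D i)) || [exists c, misses Q c [set p v | v in D i]]].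
pose bad1 := [set g : {ffun 'I_m -> 'I_n} | ~~ injectiveb g].
pose bad2 := [set g : {ffun 'I_m -> 'I_n} |
  [exists c, misses Q c [set g u | u in 'I_m]]].
have small : 4 * m ^ 2 * #|bad1 :|: bad2| <= n ^ m.
  have h1 : 8 * m ^ 2 * #|bad1| <= n ^ m.
    have := card_noninj n m; rewrite -/bad1 => h.
    have m20 : 0 < m ^ 2 by rewrite expn_gt0 m0.
    rewrite -(leq_pmul2r m20).
    have -> : 8 * m ^ 2 * #|bad1| * m ^ 2 = 2 * (4 * m ^ 4) * #|bad1|.
      by rewrite (expnD m 2 2); lia.
    apply: leq_trans (leq_mul (leq_mul (leqnn 2) len) (leqnn _)) _.
    by apply: leq_trans h _; rewrite mulnn mulnC.
  have h2 : 8 * m ^ 2 * #|bad2| <= n ^ m.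
    rewrite -(leq_pmul2l n0) -expnS; apply: leq_trans badQ.
    rewrite -/bad2; apply: leq_trans (leq_mul lek (leqnn _)).
    move: (m ^ 2) #|_| => M b.
    by rewrite leq_eqVlt; apply/orP; left; apply/eqP; ring.
  apply: leq_trans (leq_mul (leqnn _) (leq_card_setU _ _)) _.
  by move: (m ^ 2) (n ^ m) #|bad1| #|bad2| h1 h2 => M X a b; nia.
(* The family of permutations was chosen for maps on 'I_m, while D i may have
   fewer than m elements: D i is embedded in 'I_m by f, and failure on D i
   implies failure on 'I_m. *)
have transfer i : #|bad i| * n ^ m <= #|{ffun V -> 'I_n}| * #|bad1 :|: bad2|.
  have -> : n ^ m = #|{ffun 'I_m -> 'I_n}| by rewrite card_ffun !card_ord.
  rewrite -[#|{ffun V -> _}|]cardsT.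
  have ltD v : v \in D i -> index v (enum (D i)) < m.
    by move=> vD; rewrite (leq_trans _ (leD i)) // cardE index_mem mem_enum.
  pose f v : 'I_m := insubd (Ordinal m0) (index v (enum (D i))).
  have finj : {in D i &, injective f}.
    move=> u v uD vD /(congr1 val); rewrite !val_insubd !ltD // => /index_inj.
    by apply; rewrite ?mem_enum.
  apply: (resample_card finj) => [p q _ _|p g]; first by rewrite inE.
  rewrite !inE => badp gp; apply/orP; case/orP: badp => [/dinjectivePn|].
    case=> u uD [v /andP[vu vD] puv]; left; apply/injectivePn.
    exists (f u), (f v); last by rewrite !gp.
    by apply: contraNneq vu => /finj fuv; apply/eqP; rewrite fuv.
  case/existsP=> c /forallP mc; right; apply/existsP; exists c; apply/forallP=> j.
  apply: contra (mc j); apply: sub_tops; apply/subsetP=> _ /imsetP[v vD ->].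
  by rewrite -gp //; apply: imset_f.
have [p pgood] : exists p : {ffun V -> 'I_n}, forall i, p \notin bad i.
  apply: (local_lemma (D := D) (k := m ^ 2)) => //.
  - by rewrite card_ord.
  - by rewrite expn_gt0 m0.
  - move=> i p q pq; rewrite !inE.
    have -> : [set q v | v in D i] = [set p v | v in D i].
      exact: eq_in_imset.
    case/orP=> [/dinjectivePn[u uD [v vD puv]]|->]; last by rewrite orbT.
    apply/orP; left; apply/dinjectivePn; exists u => //; exists v => //.
    by rewrite !pq //; case/andP: vD.
  - move=> i; have nm0 : 0 < n ^ m by rewrite expn_gt0 n0.
    rewrite -(leq_pmul2r nm0) -mulnA.
    apply: leq_trans (leq_mul (leqnn _) (transfer i)) _.
    by rewrite mulnCA leq_mul2l small orbT.
exists p => i; have := pgood i.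
rewrite inE negb_or negbK => /andP[/dinjectiveP pi].
move=> /existsPn hc; split=> // c.
by have /forallPn[j] := hc c; rewrite negbK; exists j.
Qed.

(** * Linear extensions from colours *)

(** Each strictly increasing function refines to a linear extension, and two
    extensions that disagree on a pair witness its incomparability. *)
Lemma poset_dim_le (disp : Order.disp_t) (P : finPOrderType disp) (I : finType)
    (F : I -> P -> nat) :
  (forall i (x y : P), (x < y)%O -> F i x < F i y) ->
  (forall x y : P, ~~ (x <= y)%O -> exists i, F i y < F i x) ->
  poset_dim P <= #|I|.
Proof.
move=> Fmono Frev; rewrite /poset_dim; case: ex_minnP => k _; apply.
have [L LF] : exists L : I -> linear_order P,
    forall i x y, F i x < F i y -> lin_lt (L i) x y.
  by apply: (@fin_all_exists I (fun=> linear_order P)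
    (fun i Li => forall x y, F i x < F i y -> lin_lt Li x y)) => i;
    apply: key_linear_order.
apply/existsP; exists [ffun i => L (enum_val i)].
apply/forallP=> x; apply/forallP=> y; apply/implyP=> nxy.
apply/eqP; apply/idP/forallP => [ltxy i|allL]; first by rewrite ffunE LF ?Fmono.
apply: contraT => nltxy.
have [i ltF] : exists i, F i y < F i x.
  by apply: Frev; rewrite le_eqVlt negb_or nxy.
have := allL (enum_rank i); rewrite ffunE enum_rankK => lxy.
by have := ltn_trans lxy (LF _ _ _ ltF); rewrite ltnn.
Qed.

(** Used with a permutation that puts the colour of x on top of D(y), the two
    directions of tie-breaking make the argument independent of where x lies
    relative to the elements of D(y). *)
Lemma poset_dim_le_colouring (disp : Order.disp_t) (P : finPOrderType disp)
    (n t : nat) (Q : {ffun 'I_t -> {perm 'I_n}}) (p : {ffun P -> 'I_n}) :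
  (forall y : P, {in [set w | (w <= y)%O] &, injective p} /\
     forall c, exists j, tops (Q j) c [set p w | w in [set w | (w <= y)%O]]) ->
  poset_dim P <= 2 * t.
Proof.
move=> good.
pose N := #|P|.
(* The numbers a (N + 1) + b with b <= N are ordered as the pairs (a, b)
   lexicographically; this is used for key, and again to break ties of top
   by the size h of the down-set, which makes it strictly increasing. *)
pose rank (b : bool) (z : P) : nat :=
  if b then enum_rank z : nat else N - enum_rank z.
pose key (i : 'I_t * bool) z := Q i.1 (p z) * N.+1 + rank i.2 z.
pose top i z := \max_(w | (w <= z)%O) key i w.
pose h (z : P) := #|[set w : P | (w <= z)%O]|.
have rankN b z : rank b z <= N.
  by rewrite /rank; have := ltn_ord (enum_rank z); rewrite -/N; case: b; lia.
have hN z : h z <= N by exact: max_card.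
have -> : 2 * t = #|{: 'I_t * bool}|.
  by rewrite card_prod card_ord card_bool mulnC.
apply: (@poset_dim_le _ _ _ (fun i z => top i z * N.+1 + h z)).
  move=> i x y ltxy.
  have hlt : h x < h y.
    apply: proper_card; apply/properP; split.
      by apply/subsetP=> w; rewrite !inE => /le_trans; apply; apply: ltW.
    by exists y; rewrite !inE ?lexx // lt_geF.
  have tle : top i x <= top i y.
    apply/bigmax_leqP=> w wx; apply: (leq_bigmax_cond (F := key i)).
    exact: le_trans wx (ltW ltxy).
  nia.
move=> x y nlexy.
have [pinj /(_ (p x))[j /forall_inP topj]] := good y.
(* At most one element w of the down-set of y has the colour of x, and w <> x,
   so one of the two tie-breaks puts x above w. *)
have [b bP] : exists b, forall w : P,
    (w <= y)%O -> p w = p x -> rank b w < rank b x.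
  have [w /andP[wy /eqP pwx]|none] :=
    pickP (fun w => (w <= y)%O && (p w == p x)); last first.
    by exists true => w wy pw; have := none w; rewrite wy pw eqxx.
  have nwx : w != x by apply: contraNneq nlexy => <-.
  have nr : (enum_rank w : nat) != enum_rank x.
    by apply: contra nwx => /eqP/val_inj/enum_rank_inj->.
  exists (enum_rank w < enum_rank x) => u uy pu.
  have -> : u = w by apply: pinj; rewrite ?inE // pu pwx.
  rewrite /rank; have := ltn_ord (enum_rank x); have := ltn_ord (enum_rank w).
  rewrite -/N; case: (ltnP (enum_rank w) (enum_rank x)) => //= le ltw ltx.
  by rewrite ltn_sub2l // ltn_neqAle eq_sym nr.
exists (j, b).
have keylt w : (w <= y)%O -> key (j, b) w < key (j, b) x.
  move=> wy; rewrite /key /=; have [pwx|npwx] := eqVneq (p w) (p x).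
    by rewrite pwx ltn_add2l bP.
  have : Q j (p w) < Q j (p x).
    rewrite ltn_neqAle topj ?andbT; last by apply: imset_f; rewrite inE.
    by apply: contra npwx => /eqP/val_inj/perm_inj->.
  move=> /(leq_mul (n2 := N.+1))/(_ (leqnn _)); rewrite mulSn.
  by have := rankN b w; lia.
have lttop : top (j, b) y < top (j, b) x.
  apply: (@leq_trans (key (j, b) x)); last first.
    exact: (leq_bigmax_cond (F := key (j, b))).
  rewrite /top; elim/big_ind: _ => [|u v ? ?|w /keylt//].
    by apply: leq_ltn_trans (keylt y _).
  by rewrite gtn_max; apply/andP.
have := hN y; nia.
Qed.

(** The parameters are m = d + 1 and n = 4 m^4; then 32 m^6 is the value of
    8 m^2 n that 2^k has to reach.  If D(z) meets D(y), then z lies above an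
    element of D(y), which leaves at most m^2 such z. *)
Lemma poset_dim_degree (disp : Order.disp_t) (P : finPOrderType disp)
    (d : nat) :
  max_degree (comparability_graph P) <= d ->
  poset_dim P <= 2 * (d.+2 * up_log 2 (32 * d.+1 ^ 6)).
Proof.
move=> hP; set k := up_log _ _.
pose D (y : P) := [set w : P | (w <= y)%O].
have compare (A : {set P}) (y : P) :
    (forall w, w \in A -> (w >=< y)%O) -> #|A| <= d.+1.
  move=> AP; apply: (@leq_trans #|y |: [set w | comparability_graph P y w]|).
    apply/subset_leq_card/subsetP=> w /AP wy; rewrite !inE eq_sym.
    by rewrite /comparability_graph comparable_sym wy andbT; case: eqP.
  rewrite cardsU1 -add1n leq_add ?leq_b1 //; apply: leq_trans hP.
  exact: (leq_bigmax y).
have leD y : #|D y| <= d.+1.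
  by apply: (compare _ y) => w; rewrite inE => /le_comparable.
have degD y : #|[set z | ~~ [disjoint D y & D z]]| <= d.+1 ^ 2.
  apply: (@leq_trans #|\bigcup_(w in D y) [set z : P | (w <= z)%O]|).
    apply/subset_leq_card/subsetP=> z.
    rewrite inE -setI_eq0 => /set0Pn[w /setIP[wy]].
    by rewrite inE => wz; apply/bigcupP; exists w; rewrite // inE.
  apply: (@leq_trans (\sum_(w in D y) d.+1)); last first.
    by rewrite sum_nat_const leq_mul2r leD orbT.
  elim/big_rec2: _ => [|w X Y _ le]; first by rewrite cards0.
  apply: leq_trans (leq_card_setU _ _) (leq_add _ le).
  by apply: (compare _ w) => z; rewrite inE => /ge_comparable.
have lek : 8 * d.+1 ^ 2 * (4 * d.+1 ^ 4) <= 2 ^ k.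
  have -> : 8 * d.+1 ^ 2 * (4 * d.+1 ^ 4) = 32 * d.+1 ^ 6.
    by rewrite mulnACA -expnD.
  exact: up_logP.
have [Q [p good]] := good_colouring (ltn0Sn d) leD degD (leqnn _) lek.
exact: poset_dim_le_colouring good.
Qed.

(** * The numerical bound *)

Local Open Scope ring_scope.

(** 1/2 = 3/4 * 2/3 and ln (1 - x) <= - x. *)
Lemma ln2_ge (R : realType) : 7 / 12 <= ln 2 :> R.
Proof.
have E : ln (1 + - 4^-1) + ln (1 + - 3^-1) = - ln 2 :> R.
  by rewrite -lnV ?posrE // -lnM ?posrE; try lra; congr ln; lra.
have h1 : ln (1 + - 4^-1) <= - 4^-1 :> R by apply: le_ln1Dx; lra.
have h2 : ln (1 + - 3^-1) <= - 3^-1 :> R by apply: le_ln1Dx; lra.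
lra.
Qed.

Theorem theorem1 (R : realType) (d : nat) (hd : (5 <= d)%N)
    (disp : Order.disp_t) (P : finPOrderType disp)
    (hP : (max_degree (comparability_graph P) <= d)%N) :
  (poset_dim P)%:R <= 50 * d%:R * ln d%:R :> R.
Proof.
have dimP := poset_dim_degree hP.
set k := up_log _ _ in dimP.
have d0 : (0 : R) < d%:R by rewrite ltr0n; lia.
(* The choice of k as an upper integral logarithm gives 2^(k-1) < 32 (d+1)^6,
   and (d+1)/d <= 6/5 with 32 (6/5)^6 < 5^3 bounds this by d^9. *)
have pow_lt : (2 ^ k.-1 < d ^ 9)%N.
  apply: (@leq_trans (32 * d.+1 ^ 6)); first by apply: up_log_gtn => //; lia.
  have a6 : (5 ^ 6 * d.+1 ^ 6 <= 6 ^ 6 * d ^ 6)%N.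
    by rewrite -!expnMn leq_exp2r //; lia.
  have a3 : (5 ^ 3 <= d ^ 3)%N by rewrite leq_exp2r.
  rewrite (expnD d 3 6); move: (d.+1 ^ 6)%N (d ^ 6)%N (d ^ 3)%N a6 a3 => a b c; nia.
have k1 : k.-1%:R * ln 2 <= 9 * ln d%:R :> R.
  rewrite !mulr_natl -!lnXn ?ltr0n //; try lia.
  by rewrite ler_ln ?posrE ?exprn_gt0 // -!natrX ler_nat ltnW.
have ln2 := ln2_ge R.
have lnd : 2 * ln 2 <= ln d%:R :> R.
  rewrite mulr_natl -lnXn // ler_ln ?posrE ?exprn_gt0 // -natrX ler_nat; lia.
have d5 : 5 <= d%:R :> R by rewrite ler_nat.
have dim' : (poset_dim P)%:R <= 2 * ((d%:R + 2) * (k.-1%:R + 1)) :> R.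
  have -> : 2 * ((d%:R + 2) * (k.-1%:R + 1)) = (2 * ((d + 2) * (k.-1 + 1)))%:R :> R.
    by rewrite !natrM !natrD.
  rewrite ler_nat; apply: leq_trans dimP _; nia.
have k0 : 0 <= k.-1%:R :> R by rewrite ler0n.
have k2 : k.-1%:R <= 108 / 7 * ln d%:R :> R by nra.
apply: le_trans dim' _; nra.
Qed.
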